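(* Let $(\mathcal{L},[\cdot,\cdot])$ be the extended Schrödinger-Virasoro Lie algebra over a field $\mathbb{F}$ of characteristic zero. Then each Lie bialgebra structure on $\mathcal{L}$ is triangular coboundary. That is, for every linear map $\Delta:\mathcal{L}\to\mathcal{L}\otimes\mathcal{L}$ such that $(\mathcal{L},[\cdot,\cdot],\Delta)$ is a Lie bialgebra, there exists $r\in\mathcal{L}\otimes\mathcal{L}$ such that $\Delta(x)=x\cdot r$ for all $x\in\mathcal{L}$ and $\mathbf{c}(r)=0$.
   Context: $\mathbb{F}$ is a field of characteristic zero; all vector spaces and tensor products are over $\mathbb{F}$. The extended Schrödinger-Virasoro Lie algebra $\mathcal{L}$ is the Lie algebra with $\mathbb{F}$-basis $\{L_n,M_n,N_n,Y_p \mid n\in\mathbb{Z},\ p\in\mathbb{Z}+\tfrac12\}$ and (antisymmetric) brackets, for $m,n\in\mathbb{Z}$, $p,q\in\mathbb{Z}+\tfrac12$: $[L_m,L_n]=(n-m)L_{m+n}$, $[L_m,N_n]=nN_{m+n}$, $[L_m,M_n]=nM_{m+n}$, $[L_n,Y_p]=(p-\tfrac n2)Y_{p+n}$, $[N_m,Y_p]=Y_{m+p}$, $[N_m,M_n]=2M_{m+n}$, $[Y_p,Y_q]=(q-p)M_{p+q}$, $[M_n,Y_p]=[N_m,N_n]=[M_m,M_n]=0$. For a vector space $L$, let $\tau(x\otimes y)=y\otimes x$ on $L\otimes L$ and $\xi(x_1\otimes x_2\otimes x_3)=x_2\otimes x_3\otimes x_1$ on $L\otimes L\otimes L$. A Lie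 coalgebra is a pair $(L,\Delta)$ with $\Delta:L\to L\otimes L$ linear, $\mathrm{Im}\,\Delta\subset\mathrm{Im}(\mathrm{Id}-\tau)$ and $(\mathrm{Id}+\xi+\xi^2)\circ(\mathrm{Id}\otimes\Delta)\circ\Delta=0$. A Lie bialgebra is a triple $(L,[\cdot,\cdot],\Delta)$ such that $(L,[\cdot,\cdot])$ is a Lie algebra, $(L,\Delta)$ is a Lie coalgebra, and $\Delta([x,y])=x\cdot\Delta(y)-y\cdot\Delta(x)$ for all $x,y\in L$, where $x\cdot\sum_i a_i\otimes b_i=\sum_i([x,a_i]\otimes b_i+a_i\otimes[x,b_i])$ is the diagonal adjoint action. For $r=\sum_i a_i\otimes b_i\in L\otimes L$, set $$\mathbf{c}(r)=\sum_{i,j}[a_i,a_j]\otimes b_i\otimes b_j+\sum_{i,j}a_i\otimes[b_i,a_j]\otimes b_j+\sum_{i,j}a_i\otimes a_j\otimes[b_i,b_j].$$ A Lie bialgebra is coboundary if there is $r\in L\otimes L$ with $\Delta(x)=x\cdot r$ for all $x\in L$; it is triangular coboundary if moreover $\mathbf{c}(r)=0$ (classical Yang-Baxter equation). *)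

(* Defs.v *)
From HB Require Import structures.
From mathcomp Require Import all_boot all_order all_algebra.
From mathcomp Require Import finmap.
From mathcomp Require Import monalg.

Set Implicit Arguments.
Unset Strict Implicit.
Unset Printing Implicit Defensive.

Import GRing.Theory.

Local Open Scope ring_scope.

(* The vector space with basis K is the free module {malg F[K]}, with basis   *)
(* vectors << k >>.  Tensor powers are realized on the product bases:         *)
(*   V (x) V       is {malg F[(K * K)%type]},                                 *)
(*   V (x) V (x) V is {malg F[(K * (K * K))%type]},                           *)
(* pure tensors being given by tens.                                          *)

Section Tensors.
Variables (F : fieldType).

Definition linext (I : choiceType) (W : lmodType F) (f : I -> W)
    (x : {malg F[I]}) : W :=
  \sum_(i <- msupp x) x@_i *: f i.

Definition tens (I J : choiceType) (x : {malg F[I]}) (y : {malg F[J]}) :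
    {malg F[(I * J)%type]} :=
  linext (fun i : I => linext (fun j : J => << (i, j) >>) y) x.

End Tensors.

Declare Scope tens_scope.
Delimit Scope tens_scope with T.
Notation "x \ox y" := (tens x y) (at level 38, right associativity) :
  tens_scope.
Local Open Scope tens_scope.

Section LieBialgebra.
Variables (F : fieldType) (K : choiceType).
Local Notation V := {malg F[K]}.
Local Notation V2 := {malg F[(K * K)%type]}.
Local Notation V3 := {malg F[(K * (K * K))%type]}.

Definition is_lie_algebra (br : V -> V -> V) : Prop :=
  [/\ forall x, linear (br x),
      forall y, linear (fun x => br x y),
      forall x, br x x = 0
    & forall x y z, br x (br y z) + br y (br z x) + br z (br x y) = 0].

Definition tau : V2 -> V2 := linext (fun p : K * K => << (p.2, p.1) >>).

Definition xi : V3 -> V3 :=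
  linext (fun p : K * (K * K) => << (p.2.1, (p.2.2, p.1)) >>).

Definition id_tens (D : V -> V2) : V2 -> V3 :=
  linext (fun p : K * K => << p.1 >> \ox D << p.2 >>).

Definition is_lie_coalgebra (D : {linear V -> V2}) : Prop :=
  (forall x, exists t, D x = t - tau t) /\
  (forall x, let t := id_tens D (D x) in t + xi t + xi (xi t) = 0).

Definition adj_act (br : V -> V -> V) (x : V) : V2 -> V2 :=
  linext (fun p : K * K => br x << p.1 >> \ox << p.2 >>
                         + << p.1 >> \ox br x << p.2 >>).

Definition is_lie_bialgebra (br : V -> V -> V) (D : {linear V -> V2}) : Prop :=
  [/\ is_lie_algebra br,
      is_lie_coalgebra D
    & forall x y, D (br x y) = adj_act br x (D y) - adj_act br y (D x)].

(* The three sums are evaluated on the decomposition of r along the basis of  *)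
(* V (x) V; as br is bilinear, any decomposition of r into pure tensors gives *)
(* the same value.                                                            *)
Definition cybe (br : V -> V -> V) (r : V2) : V3 :=
  linext (fun p : K * K => linext (fun q : K * K =>
      br << p.1 >> << q.1 >> \ox << p.2 >> \ox << q.2 >>
    + << p.1 >> \ox br << p.2 >> << q.1 >> \ox << q.2 >>
    + << p.1 >> \ox << q.1 >> \ox br << p.2 >> << q.2 >>) r) r.

Definition triangular_coboundary (br : V -> V -> V) (D : {linear V -> V2}) :
    Prop :=
  exists r : V2, (forall x, D x = adj_act br x r) /\ cybe br r = 0.

End LieBialgebra.

(* The index of Y is shifted by 1/2: eY k stands for Y_{k + 1/2}.             *)
Inductive esv_index : Type :=
  | eL of int | eM of int | eN of int | eY of int.

Definition esv_encode (b : esv_index) : (int + int) + (int + int) :=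
  match b with
  | eL n => inl (inl n) | eM n => inl (inr n)
  | eN n => inr (inl n) | eY k => inr (inr k)
  end.

Definition esv_decode (s : (int + int) + (int + int)) : esv_index :=
  match s with
  | inl (inl n) => eL n | inl (inr n) => eM n
  | inr (inl n) => eN n | inr (inr k) => eY k
  end.

Lemma esv_encodeK : cancel esv_encode esv_decode.
Proof. by case. Qed.

HB.instance Definition _ := Countable.copy esv_index (can_type esv_encodeK).

Section ExtendedSchroedingerVirasoro.
Variable F : fieldType.

Definition plus_half (k : int) : F := k%:~R + 2%:R^-1.

(* In [Y_p, Y_q] the index p + q is k + l + 1 for p = k + 1/2, q = l + 1/2.   *)
Definition esv_basis_bracket (a b : esv_index) : {malg F[esv_index]} :=
  match a, b with
  | eL m, eL n => (n%:~R - m%:~R) *: << eL (m + n) >>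
  | eL m, eN n => n%:~R *: << eN (m + n) >>
  | eN n, eL m => - (n%:~R *: << eN (m + n) >>)
  | eL m, eM n => n%:~R *: << eM (m + n) >>
  | eM n, eL m => - (n%:~R *: << eM (m + n) >>)
  | eL n, eY k => (plus_half k - n%:~R / 2%:R) *: << eY (k + n) >>
  | eY k, eL n => - ((plus_half k - n%:~R / 2%:R) *: << eY (k + n) >>)
  | eN m, eY k => << eY (m + k) >>
  | eY k, eN m => - << eY (m + k) >>
  | eN m, eM n => 2%:R *: << eM (m + n) >>
  | eM n, eN m => - (2%:R *: << eM (m + n) >>)
  | eY k, eY l => (plus_half l - plus_half k) *: << eM (k + l + 1) >>
  | eM _, eY _ | eY _, eM _ => 0
  | eN _, eN _ | eM _, eM _ => 0
  end.

Definition esv_bracket (x y : {malg F[esv_index]}) : {malg F[esv_index]} :=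
  linext (fun a => linext (fun b => esv_basis_bracket a b) y) x.

End ExtendedSchroedingerVirasoro.

(* Main.v *)
Require Import Defs.
From HB Require Import structures.
From mathcomp Require Import all_boot all_order all_algebra.
From mathcomp Require Import finmap.
From mathcomp Require Import monalg.
From mathcomp Require Import zify ring.

Set Implicit Arguments.
Unset Strict Implicit.
Unset Printing Implicit Defensive.

Import GRing.Theory.

Local Open Scope ring_scope.
Local Open Scope tens_scope.

(** The heart of the matter is that every cocycle D : L -> L \ox L is a
    coboundary.  Only the operators N_m and Y_p are needed for this, together
    with two elementary facts: the coefficients of D x form finitely supported
    families, and F has characteristic zero.

    As ad N_0 is diagonalizable with eigenvalues 0 (on L and N), 1 (on Y)
    and 2 (on M), subtracting a coboundary makes D homogeneous for this weight,
    so that D N_m lies in (L+N) \ox (L+N), and D Y_p in Y \ox (L+N) plus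
    (L+N) \ox Y.  A further coboundary, given by r in (L+N) \ox (L+N), makes
    four families of coefficients of D N_1 and D Y_(1/2) vanish
    (normalizing_tensor).

    The relation [N_m, Y_p] = Y_(m+p) says that, along the translation by m, the
    coefficients of D Y_p change by an expression in D N_m that is affine in p
    (NY_cocycle_YL and NY_cocycle_YN).  Hence the slope is additive in m, so it
    is m times its value at 1, and so is the increment when the slope vanishes.
    Reading this off on each of the two legs gives two descriptions of the same
    coefficients of D N_m, each invariant under the translation of a different
    leg; comparing them moves a coefficient of D N_1 along the antidiagonal, out
    of the finite support, so it vanishes (shift_eq0).  Applied to the types
    L \ox L, L \ox N and N \ox N in turn, the type N \ox L being left to the
    normalization, this kills D N_m, and then also D Y_p but for its part in
    N \ox Y.  The relation [Y_p, Y_q] = (q - p) M_(p+q) kills that part in the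
    same way (normalized_cocycle_eq0), and then also D M_n.  Finally D L_m is
    annihilated by all N_m and Y_p,
    and a tensor with this property is zero (NY_invariant_eq0): for x of large
    index, the terms of x . t in which x acts on the first leg have a first leg
    of large index, hence cannot cancel with the others, and the brackets with
    such x detect every basis vector.

    The rest is formal.  If D x = x . r, the skew-symmetry of D makes r + tau r
    invariant, so r is skew-symmetric, and then the left-hand side of the
    co-Jacobi identity at x is x . c(r) (co_jacobi_cybe).  So c(r) is
    invariant as well, and vanishes. *)

(** * Linear extension from a basis *)

Section UnbundledLinear.
Variables (F : fieldType) (V W : lmodType F) (f : V -> W) (f_lin : linear f).

Lemma lin0 : f 0 = 0.
Proof. by have := f_lin (-1) 0 0; rewrite scaler0 add0r scaleN1r addNr. Qed.

Lemma linD x y : f (x + y) = f x + f y.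
Proof. by have := f_lin 1 x y; rewrite !scale1r. Qed.

Lemma linZ c x : f (c *: x) = c *: f x.
Proof. by have := f_lin c x 0; rewrite lin0 !addr0. Qed.

Lemma linN x : f (- x) = - f x.
Proof. by rewrite -scaleN1r linZ scaleN1r. Qed.

Lemma linB x y : f (x - y) = f x - f y.
Proof. by rewrite linD linN. Qed.

End UnbundledLinear.

Section LinearExtension.
Variables (F : fieldType) (I : choiceType).
Local Notation V := {malg F[I]}.

(** Any finite set containing the support may be used for the summation, which
    gives two vectors a common range. *)
Lemma linextEw (W : lmodType F) (f : I -> W) (x : V) (d : {fset I}) :
  (msupp x `<=` d)%fset -> linext f x = \sum_(i <- d) x@_i *: f i.
Proof.
move=> sub_xd; rewrite /linext (big_fset_incl _ sub_xd) // => i _.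
by move/mcoeff_outdom => ->; rewrite scale0r.
Qed.

Fact linext_is_linear (W : lmodType F) (f : I -> W) : linear (linext f).
Proof.
move=> c x y; pose d := (msupp (c *: x + y) `|` msupp x `|` msupp y)%fset.
rewrite !(@linextEw _ _ _ d) /d; last 3 first.
- by apply/fsubsetP=> i; rewrite !in_fsetU => ->; rewrite orbT.
- by apply/fsubsetP=> i; rewrite !in_fsetU => ->; rewrite orbT.
- by apply/fsubsetP=> i; rewrite !in_fsetU => ->.
rewrite scaler_sumr -big_split /=; apply: eq_bigr => i _.
by rewrite mcoeffD mcoeffZ scalerDl scalerA.
Qed.

HB.instance Definition _ (W : lmodType F) (f : I -> W) :=
  GRing.isLinear.Build F V W _ (linext f) (linext_is_linear f).

Lemma linextU (W : lmodType F) (f : I -> W) i : linext f << i >> = f i.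
Proof.
rewrite (@linextEw _ _ _ [fset i]%fset) ?msuppU_le //.
by rewrite big_seq_fset1 mcoeffUU scale1r.
Qed.

Lemma malg_linextE (x : V) : x = linext (fun i => << i >>) x.
Proof.
rewrite [LHS]monalgE; apply: eq_bigr => i _.
by apply/malgP=> j; rewrite mcoeffZ !mcoeffU mulr_natr.
Qed.

Lemma eq_linext (W : lmodType F) (f g : I -> W) : f =1 g -> linext f =1 linext g.
Proof. by move=> fg x; apply: eq_bigr => i _; rewrite fg. Qed.

Lemma linextD (W : lmodType F) (f g : I -> W) x :
  linext (fun i => f i + g i) x = linext f x + linext g x.
Proof. by rewrite -big_split; apply: eq_bigr => i _; rewrite scalerDr. Qed.

Lemma linextN (W : lmodType F) (f : I -> W) x :
  linext (fun i => - f i) x = - linext f x.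
Proof. by rewrite -sumrN; apply: eq_bigr => i _; rewrite scalerN. Qed.

Lemma linextZ (W : lmodType F) c (f : I -> W) x :
  linext (fun i => c *: f i) x = c *: linext f x.
Proof.
rewrite /linext scaler_sumr; apply: eq_bigr => i _.
by rewrite !scalerA mulrC.
Qed.

Lemma linear_linext (W W' : lmodType F) (h : W -> W') (f : I -> W) (x : V) :
  linear h -> h (linext f x) = linext (fun i => h (f i)) x.
Proof.
move=> h_lin.
pose h' : {linear W -> W'} := HB.pack h (GRing.isLinear.Build _ _ _ _ h h_lin).
rewrite -[h]/(h' : W -> W') linear_sum.
by apply: eq_bigr => i _; rewrite linearZ.
Qed.

Lemma eq_linear (W : lmodType F) (f g : V -> W) :
  linear f -> linear g -> (forall i, f << i >> = g << i >>) -> f =1 g.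
Proof.
move=> f_lin g_lin fg x; rewrite [x]malg_linextE !linear_linext //.
exact: eq_linext.
Qed.

End LinearExtension.

Lemma exchange_linext (F : fieldType) (I J : choiceType) (W : lmodType F)
    (f : I -> J -> W) (x : {malg F[I]}) (y : {malg F[J]}) :
  linext (fun i => linext (f i) y) x = linext (fun j => linext (f^~ j) x) y.
Proof.
rewrite /linext; under eq_bigr do rewrite scaler_sumr.
rewrite exchange_big /=; apply: eq_bigr => j _; rewrite scaler_sumr.
by apply: eq_bigr => i _; rewrite !scalerA mulrC.
Qed.

(** * Tensors and derivations of tensor products *)

Section Tensor.
Variables (F : fieldType) (I J : choiceType).
Implicit Types (x : {malg F[I]}) (y : {malg F[J]}).
Local Notation V2 := {malg F[(I * J)%type]}.

Lemma tensl_linear y : linear (fun x => x \ox y).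
Proof. exact: linearP. Qed.

Lemma tensr_linear x : linear (fun y => x \ox y).
Proof.
move=> c y y'; rewrite /tens -linextZ -linextD.
by apply: eq_linext => i; rewrite linearP.
Qed.

Lemma tensDl x x' y : (x + x') \ox y = x \ox y + x' \ox y.
Proof. exact: linearD. Qed.

Lemma tensNl x y : (- x) \ox y = - (x \ox y).
Proof. exact: linearN. Qed.

Lemma tensDr x y y' : x \ox (y + y') = x \ox y + x \ox y'.
Proof. by have := tensr_linear x 1 y y'; rewrite !scale1r. Qed.

Lemma tens0r x : x \ox (0 : {malg F[J]}) = 0.
Proof. by apply: (addrI (x \ox 0)); rewrite -tensDr !addr0. Qed.

Lemma tensNr x y : x \ox (- y) = - (x \ox y).
Proof. by apply: (addrI (x \ox y)); rewrite -tensDr !subrr tens0r. Qed.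

Lemma tensUU i j : << i >> \ox << j >> = << (i, j) >> :> V2.
Proof. by rewrite /tens !linextU. Qed.

(** Arguing on pure tensors of arbitrary vectors, rather than on basis vectors,
    lets bilinear identities be applied as they stand. *)
Lemma eq_linear_tens (W : lmodType F) (f g : V2 -> W) :
  linear f -> linear g -> (forall x y, f (x \ox y) = g (x \ox y)) -> f =1 g.
Proof.
by move=> f_lin g_lin fg; apply: eq_linear => // -[i j]; rewrite -tensUU.
Qed.

(** The part of a tensor with second leg [j] (resp. first leg [i]), read as a
    vector in the other leg: slices turn the coefficients of an action on one leg
    of a tensor into coefficients of the action on vectors. *)
Definition slice1 (j : J) : V2 -> {malg F[I]} :=
  linext (fun p : I * J => if p.2 == j then << p.1 >> else 0).

Definition slice2 (i : I) : V2 -> {malg F[J]} :=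
  linext (fun p : I * J => if p.1 == i then << p.2 >> else 0).

HB.instance Definition _ j := GRing.Linear.copy (slice1 j) (linext _).
HB.instance Definition _ i := GRing.Linear.copy (slice2 i) (linext _).

Fact mcoeff_linear (K : choiceType) (k : K) :
  linear (fun x : {malg F[K]} => x@_k : F^o).
Proof. by move=> c x y; rewrite mcoeffD mcoeffZ. Qed.

Lemma slice1E j t i : (slice1 j t)@_i = t@_(i, j).
Proof.
apply: (@eq_linear F _ F^o (fun t => (slice1 j t)@_i) (fun t => t@_(i, j))).
- by move=> c x y; rewrite linearP mcoeffD mcoeffZ.
- exact: mcoeff_linear.
case=> i' j'; rewrite /slice1 linextU /= mcoeffU xpair_eqE andbC.
by case: (j' == j); rewrite ?mcoeffU ?mcoeff0.
Qed.

Lemma slice2E i t j : (slice2 i t)@_j = t@_(i, j).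
Proof.
apply: (@eq_linear F _ F^o (fun t => (slice2 i t)@_j) (fun t => t@_(i, j))).
- by move=> c x y; rewrite linearP mcoeffD mcoeffZ.
- exact: mcoeff_linear.
case=> i' j'; rewrite /slice2 linextU /= mcoeffU xpair_eqE.
by case: (i' == i); rewrite ?mcoeffU ?mcoeff0.
Qed.

Lemma slice1_tens j x y : slice1 j (x \ox y) = y@_j *: x.
Proof.
apply: (@eq_linear F _ _ (fun x => slice1 j (x \ox y)) (fun x => y@_j *: x)).
- by move=> c u v /=; rewrite tensl_linear linearP.
- by move=> c u v /=; rewrite linearP.
move=> i; apply: (@eq_linear F _ _ (fun y => slice1 j (<< i >> \ox y))
  (fun y => y@_j *: << i >>)).
- by move=> c u v; rewrite tensr_linear !linearP.
- by move=> c u v; rewrite mcoeffD mcoeffZ scalerDl scalerA.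
move=> j'; rewrite tensUU /slice1 linextU mcoeffU /=.
by case: (j' == j); rewrite ?scale1r ?scale0r.
Qed.

Lemma slice2_tens i x y : slice2 i (x \ox y) = x@_i *: y.
Proof.
apply: (@eq_linear F _ _ (fun x => slice2 i (x \ox y)) (fun x => x@_i *: y)).
- by move=> c u v /=; rewrite tensl_linear linearP.
- by move=> c u v /=; rewrite mcoeffD mcoeffZ scalerDl scalerA.
move=> i'; apply: (@eq_linear F _ _ (fun y => slice2 i (<< i' >> \ox y))
  (fun y => << i' >>@_i *: y)).
- by move=> c u v; rewrite tensr_linear !linearP.
- by move=> c u v /=; rewrite linearP.
move=> j; rewrite tensUU /slice2 linextU mcoeffU /=.
by case: (i' == i); rewrite ?scale1r ?scale0r.
Qed.

Lemma mcoeff_tens x y i j : (x \ox y)@_(i, j) = x@_i * y@_j.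
Proof. by rewrite -slice1E slice1_tens mcoeffZ mulrC. Qed.

(** The operator [f \ox id + id \ox g]; with [f] and [g] given by a bracket,
    it is the diagonal action on a tensor product. *)
Definition leib (f : {malg F[I]} -> {malg F[I]})
    (g : {malg F[J]} -> {malg F[J]}) : V2 -> V2 :=
  linext (fun p => f << p.1 >> \ox << p.2 >> + << p.1 >> \ox g << p.2 >>).

HB.instance Definition _ f g := GRing.Linear.copy (leib f g) (linext _).

Variables (f : {malg F[I]} -> {malg F[I]}) (g : {malg F[J]} -> {malg F[J]}).
Hypotheses (f_lin : linear f) (g_lin : linear g).

Lemma leib_tens x y : leib f g (x \ox y) = f x \ox y + x \ox g y.
Proof.
apply: (@eq_linear F _ _ (fun x => leib f g (x \ox y))
  (fun x => f x \ox y + x \ox g y)).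
- by move=> c u v /=; rewrite tensl_linear linearP.
- by move=> c u v /=; rewrite f_lin !tensl_linear scalerDr addrACA.
move=> i; apply: (@eq_linear F _ _ (fun y => leib f g (<< i >> \ox y))
  (fun y => f << i >> \ox y + << i >> \ox g y)).
- by move=> c u v; rewrite tensr_linear !linearP.
- by move=> c u v; rewrite g_lin !tensr_linear /= scalerDr addrACA.
by move=> j; rewrite tensUU /leib linextU.
Qed.

Lemma leibE t i j :
  (leib f g t)@_(i, j) = (f (slice1 j t))@_i + (g (slice2 i t))@_j.
Proof.
apply: (@eq_linear_tens F^o (fun t => (leib f g t)@_(i, j))
  (fun t => (f (slice1 j t))@_i + (g (slice2 i t))@_j)).
- by move=> c x y; rewrite linearP mcoeffD mcoeffZ.
- move=> c x y; rewrite !linearP f_lin g_lin !mcoeffD !mcoeffZ.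
  by rewrite scalerDr addrACA.
move=> x y; apply: etrans (congr1 _ (leib_tens x y)) _.
apply: etrans (mcoeffD _ _ _) _; rewrite slice1_tens slice2_tens.
rewrite (linZ f_lin) (linZ g_lin) !mcoeffZ.
by congr (_ + _); apply: etrans (mcoeff_tens _ _ _ _) _; rewrite // mulrC.
Qed.

End Tensor.

(** Locked, so that unification treats it as an atom. *)
HB.lock Definition tens3 (F : fieldType) (K : choiceType)
  (u v w : {malg F[K]}) : {malg F[(K * (K * K))%type]} := u \ox v \ox w.

(** * The coboundary cobracket of a skew-symmetric tensor *)

Section CoboundaryCobracket.
Variables (F : fieldType) (K : choiceType).
Local Notation V := {malg F[K]}.
Local Notation V2 := {malg F[(K * K)%type]}.
Local Notation V3 := {malg F[(K * (K * K))%type]}.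
Variable br : V -> V -> V.
Hypothesis br_lie : is_lie_algebra br.

Lemma lie_linearr x : linear (br x).
Proof. by have [] := br_lie. Qed.

Lemma lie_linearl y : linear (fun x => br x y).
Proof. by have [] := br_lie. Qed.

Lemma lie_skew x y : br x y = - br y x.
Proof.
have [_ _ br_alt _] := br_lie.
have brDl u v w : br (u + v) w = br u w + br v w := linD (lie_linearl w) u v.
have := br_alt (x + y); rewrite (linD (lie_linearr _)) !brDl !br_alt add0r addr0.
by rewrite addrC => /eqP; rewrite addr_eq0 => /eqP.
Qed.

(** The Jacobi identity, as the statement that [ad] is a representation. *)
Lemma lie_ad x y z : br (br x y) z = br x (br y z) - br y (br x z).
Proof.
have [_ _ _ jacobi] := br_lie.
rewrite (lie_skew (br x y)) (lie_skew x z) (linN (lie_linearr y)) opprK.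
by apply/eqP; rewrite eq_sym -addr_eq0 jacobi.
Qed.

HB.instance Definition _ := GRing.Linear.copy (@tau F K) (linext _).
HB.instance Definition _ := GRing.Linear.copy (@xi F K) (linext _).
HB.instance Definition _ D := GRing.Linear.copy (@id_tens F K D) (linext _).

Lemma adj_act_tens x u v : adj_act br x (u \ox v) = br x u \ox v + u \ox br x v.
Proof. exact: leib_tens (lie_linearr x) (lie_linearr x) u v. Qed.

Lemma adj_act_linext x t : adj_act br x t = linext
  (fun p => br x << p.1 >> \ox << p.2 >> + << p.1 >> \ox br x << p.2 >>) t.
Proof. by []. Qed.

Lemma adj_act_linear x : linear (adj_act br x).
Proof. exact: linearP. Qed.

Lemma adj_actD x s t : adj_act br x (s + t) = adj_act br x s + adj_act br x t.
Proof. exact: linearD. Qed.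

Lemma adj_act_linearl (t : V2) : linear (fun x => adj_act br x t).
Proof.
move=> c x y; rewrite /adj_act -linextZ -linextD; apply: eq_linext => p.
by rewrite !lie_linearl tensl_linear tensr_linear scalerDr addrACA.
Qed.

Lemma tens3D (u u' v w : V) :
  (tens3 (u + u') v w = tens3 u v w + tens3 u' v w) *
  (tens3 v (u + u') w = tens3 v u w + tens3 v u' w) *
  (tens3 v w (u + u') = tens3 v w u + tens3 v w u').
Proof.
rewrite tens3.unlock; split; [split|].
- exact: tensDl.
- exact: etrans (congr1 _ (tensDl _ _ _)) (tensDr _ _ _).
- exact: etrans (congr1 _ (tensDr _ _ _)) (tensDr _ _ _).
Qed.

Lemma tens3N (u v w : V) : (tens3 (- u) v w = - tens3 u v w) *
  (tens3 v (- u) w = - tens3 v u w) * (tens3 v w (- u) = - tens3 v w u).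
Proof.
rewrite tens3.unlock; split; [split|].
- exact: tensNl.
- exact: etrans (congr1 _ (tensNl _ _)) (tensNr _ _).
- exact: etrans (congr1 _ (tensNr _ _)) (tensNr _ _).
Qed.

Definition adj_act3 (x : V) : V3 -> V3 := leib (br x) (adj_act br x).

HB.instance Definition _ x := GRing.Linear.copy (adj_act3 x) (linext _).

Lemma adj_act3_tens x u v w : adj_act3 x (u \ox v \ox w) =
  br x u \ox v \ox w + u \ox br x v \ox w + u \ox v \ox br x w.
Proof.
rewrite /adj_act3 leib_tens; first by rewrite adj_act_tens tensDr addrA.
  exact: lie_linearr.
exact: linearP.
Qed.

Lemma tens3_act x (u v w : V) : adj_act3 x (tens3 u v w) =
  tens3 (br x u) v w + tens3 u (br x v) w + tens3 u v (br x w).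
Proof. by rewrite tens3.unlock; apply: adj_act3_tens. Qed.

Lemma tau_tens (u v : V) : tau (u \ox v) = v \ox u.
Proof.
apply: (@eq_linear F _ _ (fun u => tau (u \ox v)) (fun u => v \ox u)).
- by move=> c x y /=; rewrite tensl_linear linearP.
- exact: tensr_linear.
move=> i; apply: (@eq_linear F _ _ (fun v => tau (<< i >> \ox v))
  (fun v => v \ox << i >>)).
- by move=> c x y /=; rewrite tensr_linear linearP.
- exact: tensl_linear.
by move=> j; rewrite !tensUU /tau linextU.
Qed.

Lemma linext_tau (W : lmodType F) (f : K * K -> W) t :
  linext f (tau t) = linext (fun p => f (p.2, p.1)) t.
Proof.
rewrite /tau linear_linext; last exact: linearP.
by apply: eq_linext => p; rewrite linextU.
Qed.

Lemma xi_tens (u v w : V) : xi (u \ox v \ox w) = v \ox w \ox u.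
Proof.
apply: (@eq_linear F _ _ (fun u => xi (u \ox v \ox w)) (fun u => v \ox w \ox u)).
- by move=> c x y /=; rewrite tensl_linear linearP.
- by move=> c x y /=; rewrite !tensr_linear.
move=> i; apply: (@eq_linear F _ _ (fun v => xi (<< i >> \ox v \ox w))
  (fun v => v \ox w \ox << i >>)).
- by move=> c x y /=; rewrite tensl_linear tensr_linear linearP.
- exact: tensl_linear.
move=> j; apply: (@eq_linear F _ _ (fun w => xi (<< i >> \ox << j >> \ox w))
  (fun w => << j >> \ox w \ox << i >>)).
- by move=> c x y /=; rewrite !tensr_linear linearP.
- by move=> c x y /=; rewrite tensl_linear tensr_linear.
by move=> k; rewrite !tensUU /xi linextU.
Qed.

Lemma tens3_xi (u v w : V) : xi (tens3 u v w) = tens3 v w u.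
Proof. by rewrite tens3.unlock; apply: xi_tens. Qed.

Lemma id_tens_tens (D : V -> V2) u v : linear D ->
  id_tens D (u \ox v) = u \ox D v.
Proof.
move=> D_lin.
apply: (@eq_linear F _ _ (fun u => id_tens D (u \ox v)) (fun u => u \ox D v)).
- by move=> c x y /=; rewrite tensl_linear linearP.
- exact: tensl_linear.
move=> i; apply: (@eq_linear F _ _ (fun v => id_tens D (<< i >> \ox v))
  (fun v => << i >> \ox D v)).
- by move=> c x y /=; rewrite tensr_linear linearP.
- by move=> c x y /=; rewrite D_lin tensr_linear.
by move=> j; rewrite !tensUU /id_tens linextU.
Qed.

(** The second tensor power is a representation, so that [x |-> x . t] is a
    cocycle. *)
Lemma adj_act_bracket x y (t : V2) :
  adj_act br (br x y) t = adj_act br x (adj_act br y t)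
                          - adj_act br y (adj_act br x t).
Proof.
apply: (@eq_linear_tens F _ _ _ _ (fun t => adj_act br x (adj_act br y t)
  - adj_act br y (adj_act br x t))); first exact: adj_act_linear.
  move=> c u v /=; rewrite !(adj_act_linear x, adj_act_linear y).
  by rewrite opprD addrACA scalerBr.
move=> u v; have adE := lie_ad; have actE := adj_act_tens; have actD := adj_actD.
move: (@tensDl F K K) (@tensDr F K K) (@tensNl F K K) (@tensNr F K K).
(* Abstracting the operations keeps the rewriting below from unfolding them. *)
move: (adj_act br) (@tens F K K) actE actD => act ot actE actD Dl Dr Nl Nr.
rewrite !(actE, actD) !adE !(Dl, Dr, Nl, Nr).
do ![move: (ot _ _) => ?].
by apply/malgP=> k; rewrite !(mcoeffD, mcoeffN); ring.
Qed.

Lemma adj_act_tau x t : adj_act br x (tau t) = tau (adj_act br x t).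
Proof.
apply: (@eq_linear_tens F _ _ _ (fun t => adj_act br x (tau t))
  (fun t => tau (adj_act br x t))).
- by move=> c u v /=; rewrite (linearP (@tau F K)) adj_act_linear.
- by move=> c u v /=; rewrite adj_act_linear (linearP (@tau F K)).
have tauD (s t' : V2) : tau (s + t') = tau s + tau t' by apply: linearD.
move=> u v; have actE := adj_act_tens; have tauE := tau_tens.
move: (adj_act br) (@tens F K K) (@tau F K) actE tauE tauD.
by move=> act ot tw actE tauE tauD; rewrite !(tauE, actE, tauD) addrC.
Qed.

Section Skew.
Variable r : V2.
Hypothesis r_skew : tau r = - r.

(** Summation over the pairs of terms of [r].  As [r] is skew-symmetric, flipping
    the legs of one summation index changes the sign of the sum; exchanging the
    two indices does not change it. *)
Let S (f : K * K -> K * K -> V3) : V3 := linext (fun p => linext (f p) r) r.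

Let SD f g : S (fun p q => f p q + g p q) = S f + S g.
Proof. by rewrite /S -linextD; apply: eq_linext => p; rewrite linextD. Qed.

Let SN f : S (fun p q => - f p q) = - S f.
Proof. by rewrite /S -linextN; apply: eq_linext => p; rewrite linextN. Qed.

Let eqS f g : (forall p q, f p q = g p q) -> S f = S g.
Proof. by move=> fg; do 2![apply: eq_linext => ?]. Qed.

Let linS (h : V3 -> V3) f : linear h -> h (S f) = S (fun p q => h (f p q)).
Proof.
by move=> hP; rewrite /S linear_linext //; apply: eq_linext => p;
  rewrite linear_linext.
Qed.

Let swapS f : S f = S (fun p q => f q p).
Proof. exact: exchange_linext. Qed.

Lemma linext_skew (W : lmodType F) (f : K * K -> W) :
  linext (fun p => f (p.2, p.1)) r = - linext f r.
Proof.
by rewrite -linext_tau r_skew; apply: linearN.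
Qed.

Let flipS1 f : S (fun p q => f (p.2, p.1) q) = - S f.
Proof. exact: (linext_skew (fun p => linext (f p) r)). Qed.

Let rotS1 f : S f = S (fun p q => - f (q.2, q.1) p).
Proof. by rewrite SN (swapS (fun p q => f (q.2, q.1) p)) (flipS1 f) opprK. Qed.

Let rotS2 f : S f = S (fun p q => - f q (p.2, p.1)).
Proof. by rewrite SN (flipS1 (fun p q => f q p)) opprK; apply: swapS. Qed.

Let flipS f : S f = S (fun p q => f (p.2, p.1) (q.2, q.1)).
Proof.
rewrite (flipS1 (fun p q => f p (q.2, q.1))) -linextN; apply: eq_linext => p.
by rewrite (linext_skew (f p)) opprK.
Qed.

Let D y := adj_act br y r.

Let tens_D (u v : V) : u \ox D v = linext (fun q =>
  tens3 u (br v << q.1 >>) << q.2 >> + tens3 u << q.1 >> (br v << q.2 >>)) r.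
Proof.
rewrite /D adj_act_linext (linear_linext _ _ (tensr_linear u)).
by apply: eq_linext => q; rewrite tens3.unlock; apply: tensDr.
Qed.

(** The term of [id_tens D (D x)] coming from the terms [a \ox b] and
    [a' \ox b'] of [r]. *)
Let T x (a b a' b' : V) : V3 :=
  tens3 (br x a) (br b a') b' + tens3 (br x a) a' (br b b')
  + (tens3 a (br (br x b) a') b' + tens3 a a' (br (br x b) b')).

Let id_tens_D x : id_tens D (D x) =
  S (fun p q => T x << p.1 >> << p.2 >> << q.1 >> << q.2 >>).
Proof.
have DE (u v : V) : id_tens D (u \ox v) = u \ox D v.
  exact: id_tens_tens (adj_act_linearl r).
rewrite {2}/D adj_act_linext linear_linext; last exact: linearP.
apply: eq_linext => p; rewrite linearD.
apply: (etrans (congr2 +%R (DE _ _) (DE _ _))).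
apply: (etrans (congr2 +%R (tens_D _ _) (tens_D _ _))).
by rewrite -linextD; apply: eq_linext.
Qed.

Let xiD (s t : V3) : xi (s + t) = xi s + xi t.
Proof. exact: linearD. Qed.

Let xiT x (a b a' b' : V) : V3 :=
  tens3 (br b a') b' (br x a) + tens3 a' (br b b') (br x a)
  + (tens3 (br (br x b) a') b' a + tens3 a' (br (br x b) b') a).

Let xiTE x a b a' b' : xi (T x a b a' b') = xiT x a b a' b'.
Proof. by rewrite /T !xiD !tens3_xi. Qed.

(** The two halves of the second rotation are kept apart because different
    symmetries of [S] bring them to the shape of the terms of [x . c(r)]. *)
Let xi2T13 x (a b a' b' : V) : V3 :=
  tens3 b' (br x a) (br b a') + tens3 b' a (br (br x b) a').

Let xi2T24 x (a b a' b' : V) : V3 :=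
  tens3 (br b b') (br x a) a' + tens3 (br (br x b) b') a a'.

Let xi2TE x a b a' b' :
  xi (xi (T x a b a' b')) = xi2T13 x a b a' b' + xi2T24 x a b a' b'.
Proof. by rewrite xiTE !xiD !tens3_xi addrACA. Qed.

Let cybe_term (a b a' b' : V) : V3 :=
  tens3 (br a a') b b' + tens3 a (br b a') b' + tens3 a a' (br b b').

Let cybeE : cybe br r =
  S (fun p q => cybe_term << p.1 >> << p.2 >> << q.1 >> << q.2 >>).
Proof. by apply: eqS => p q; rewrite /cybe_term tens3.unlock. Qed.

(** The terms of [x . c(r)] are those of the cyclic sum, up to flips and
    exchanges of the summation indices: the brackets with [x] outside match one by
    one, and the nested ones match in pairs, by the Jacobi identity. *)
Let adj_act3_term x a b a' b' : adj_act3 x (cybe_term a b a' b') =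
  T x a b a' b' - xiT x b' a' a b
  + (- xi2T13 x a' b' b a + xi2T24 x b a b' a').
Proof.
have lie_deriv u v : br x (br u v) = br (br x u) v + br u (br x v).
  by rewrite lie_ad subrK.
have act3D (s t : V3) : adj_act3 x (s + t) = adj_act3 x s + adj_act3 x t.
  exact: linearD.
rewrite /cybe_term !act3D !tens3_act !lie_deriv /T /xiT /xi2T13 /xi2T24.
rewrite (lie_skew a' a) (lie_skew a' b) (lie_skew b' b).
rewrite (lie_skew (br x a') a) (lie_skew (br x a') b) (lie_skew (br x b') b).
rewrite !(tens3D, tens3N).
do ![move: (tens3 _ _ _) => ?].
by apply/malgP=> k; rewrite !(mcoeffD, mcoeffN); ring.
Qed.

(** For a skew-symmetric [r], the co-Jacobi identity for [x |-> x . r] amounts to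
    the invariance of [c(r)]. *)
Theorem co_jacobi_cybe x :
  let t := id_tens D (D x) in
  t + xi t + xi (xi t) = adj_act3 x (cybe br r).
Proof.
pose A p q := T x << p.1 >> << p.2 >> << q.1 >> << q.2 >>.
pose B p q := - xiT x << q.2 >> << q.1 >> << p.1 >> << p.2 >>.
pose C p q := - xi2T13 x << q.1 >> << q.2 >> << p.2 >> << p.1 >>.
pose E p q := xi2T24 x << p.2 >> << p.1 >> << q.2 >> << q.1 >>.
pose f1 p q := xiT x << p.1 >> << p.2 >> << q.1 >> << q.2 >>.
pose f2 p q := xi2T13 x << p.1 >> << p.2 >> << q.1 >> << q.2 >>.
pose f3 p q := xi2T24 x << p.1 >> << p.2 >> << q.1 >> << q.2 >>.
have xiS f : xi (S f) = S (fun p q => xi (f p q)) by apply: linS; apply: linearP.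
have xiA : xi (S A) = S B.
  apply: etrans (xiS A) (etrans (eqS (g := f1) _) (rotS1 f1)) => p q.
  exact: xiTE.
have xi2A : xi (xi (S A)) = S C + S E.
  apply: etrans (congr1 (@xi F K) (xiS A)) (etrans (xiS _) _).
  apply: etrans (eqS (g := fun p q => f2 p q + f3 p q) _) (etrans (SD f2 f3) _).
    by move=> p q; apply: xi2TE.
  have -> : S C = S f2 by apply: esym (rotS2 f2).
  have -> : S E = S f3 by apply: esym (flipS f3).
  by [].
have tA : id_tens D (D x) = S A by apply: id_tens_D.
rewrite /= tA xi2A xiA cybeE (linS _ (linearP (adj_act3 x))).
transitivity (S (fun p q => A p q + B p q + (C p q + E p q))); last first.
  by apply: eqS => p q; apply: esym (adj_act3_term _ _ _ _ _).
have -> := SD (fun p q => A p q + B p q) (fun p q => C p q + E p q).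
have -> : S (fun p q => A p q + B p q) = S A + S B by apply: SD.
have -> : S (fun p q => C p q + E p q) = S C + S E by apply: SD.
by [].
Qed.

End Skew.
End CoboundaryCobracket.

(** * The actions of N and Y *)

(** The eigenvalue of [ad N_0]; the weights form a grading of the algebra. *)
Definition wt (a : esv_index) : nat :=
  match a with eL _ | eN _ => 0 | eY _ => 1 | eM _ => 2 end.

Section Coadjoint.
Variable F : fieldType.
Local Notation V := {malg F[esv_index]}.
Local Notation br := (@esv_bracket F).

(** The two families that drive the whole argument: no nonzero vector commutes
    with all of them, and they generate M as well. *)
Definition is_NY (x : esv_index) : bool :=
  match x with eN _ | eY _ => true | eL _ | eM _ => false end.

(** The transpose of [ad x]: it computes the coefficient of [[x, u]] at [a]
    from the coefficients of [u]. *)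
Definition coad (x a : esv_index) (u : esv_index -> F) : F :=
  match x, a with
  | eN m, eN n => - m%:~R * u (eL (n - m))
  | eN m, eM n => 2%:R * u (eM (n - m))
  | eN m, eY k => u (eY (k - m))
  | eY k, eY l =>
      - (plus_half F k - (l - k)%:~R / 2%:R) * u (eL (l - k)) - u (eN (l - k))
  | eY k, eM n =>
      (plus_half F (n - k - 1) - plus_half F k) * u (eY (n - k - 1))
  | _, _ => 0
  end.

Lemma eq_coad x a u v : u =1 v -> coad x a u = coad x a v.
Proof. by move=> uv; case: x a => [] ? [] ? //=; rewrite !uv. Qed.

Lemma coad_lin x a c u v :
  coad x a (fun i => c * u i + v i) = c * coad x a u + coad x a v.
Proof. by case: x a => [] ? [] ? /=; ring. Qed.

Lemma esv_bracket_linearr (x : V) : linear (br x).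
Proof.
move=> c y z; rewrite /esv_bracket -linextZ -linextD.
by apply: eq_linext => i; rewrite linearP.
Qed.

Lemma esv_bracketUU i j : br << i >> << j >> = esv_basis_bracket F i j.
Proof. by rewrite /esv_bracket !linextU. Qed.

Lemma coadE x u a : is_NY x -> (br << x >> u)@_a = coad x a (fun i => u@_i).
Proof.
move=> NYx.
apply: (@eq_linear F _ F^o (fun u => (br << x >> u)@_a)
  (fun u => coad x a (fun i => u@_i))).
- by move=> c y z /=; rewrite esv_bracket_linearr mcoeffD mcoeffZ.
- move=> c y z /=; rewrite -coad_lin; apply: eq_coad => i.
  by rewrite mcoeffD mcoeffZ.
move=> i; rewrite esv_bracketUU.
have eqL m n : (eL m == eL n) = (m == n) by [].
have eqM m n : (eM m == eM n) = (m == n) by [].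
have eqN m n : (eN m == eN n) = (m == n) by [].
have eqY m n : (eY m == eY n) = (m == n) by [].
case: x NYx => //= n _; case: i => m; case: a => k /=;
  rewrite ?mcoeffN ?mcoeffZ ?mcoeff0 ?mcoeffU ?mulr0 ?oppr0 //.
all: rewrite ?(eqL, eqM, eqN, eqY).
all: rewrite ?addr0 ?add0r //.
all: try by have -> : (n + m == k) = (m == k - n) by lia.
- have -> : (m + n == k) = (m == k - n) by lia.
  by rewrite mulNr.
- have -> : (n + m == k) = (m == k - n) by lia.
  by case: eqP => [->|_]; rewrite ?mulr0 ?mulNr ?oppr0 ?mulr1.
- by have -> : (m + n == k) = (m == k - n) by lia.
- have -> : (n + m + 1 == k) = (m == k - n - 1) by lia.
  by case: eqP => [->|_]; rewrite ?mulr0.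
Qed.

Lemma coad_N0 a (u : esv_index -> F) : coad (eN 0) a u = (wt a)%:R * u a.
Proof. by case: a => n /=; rewrite ?subr0 ?mulNr ?mul0r ?oppr0 ?mul1r. Qed.

(** Bracketing with [x] raises the weight by [wt x]. *)
Lemma coad_wt x a (u : esv_index -> F) : is_NY x ->
  (forall i, (wt i + wt x)%N = wt a -> u i = 0) -> coad x a u = 0.
Proof.
by case: x => // n _ u0; case: a u0 => m u0 //=;
  rewrite ?u0 // ?mulr0 ?subrr ?oppr0 ?addr0.
Qed.

End Coadjoint.

(** * Tensors annihilated by N and Y *)

Definition idx (a : esv_index) : int :=
  match a with eL n | eM n | eN n | eY n => n end.

Lemma mcoeff_bound (F : fieldType) (I : choiceType) (t : {malg F[I]})
    (h : I -> int) :
  exists B : nat, forall i, (B < `|h i|)%N -> t@_i = 0.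
Proof.
exists (\max_(i <- msupp t) `|h i|)%N => i.
apply: contraTeq; rewrite mcoeff_neq0 -leqNgt => it.
exact: leq_bigmax_seq.
Qed.

Lemma intr_eq0_char0 (F : fieldType) (charF0 : [pchar F] =i pred0) (m : int) :
  (m%:~R == 0 :> F) = (m == 0).
Proof.
have F0 := (pcharf0P F).1 charF0.
case: m => n; first by rewrite -pmulrn F0.
by rewrite NegzE mulrNz oppr_eq0 -pmulrn F0.
Qed.

Section Invariants.
Variables (F : fieldType) (charF0 : [pchar F] =i pred0).
Local Notation br := (@esv_bracket F).

Let two_neq0 : 2%:R != 0 :> F.
Proof. by rewrite ((pcharf0P F).1 charF0). Qed.

(** Acting on the first leg by a vector [x] of large index gives first legs of
    large index, which the action on the second leg cannot produce: so [x] must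
    annihilate the first leg alone.  Letting the index of [x] vary then shows that
    the first leg has no component of type L or N (by Y), M (by N) or Y (by Y).
    The second factor [J] is arbitrary in order to cover both the second and the
    third tensor powers. *)
Lemma NY_invariant_eq0 (J : choiceType)
    (g : esv_index -> {malg F[J]} -> {malg F[J]})
    (t : {malg F[(esv_index * J)%type]}) :
  (forall x, linear (g x)) ->
  (forall x, is_NY x -> leib (br << x >>) (g x) t = 0) -> t = 0.
Proof.
move=> g_lin t_inv.
have [B tB] := mcoeff_bound t (fun p => idx p.1).
have key x a q : is_NY x -> (B < `|idx a|)%N -> coad x a (fun i => t@_(i, q)) = 0.
  move=> NYx Ba; have := congr1 (mcoeff (a, q)) (t_inv x NYx).
  rewrite leibE ?mcoeff0 //; last exact: esv_bracket_linearr.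
  have -> : slice2 a t = 0.
    by apply/malgP=> j; rewrite slice2E mcoeff0; apply: tB.
  rewrite (lin0 (g_lin x)) mcoeff0 addr0 coadE // => <-.
  by apply: eq_coad => i; rewrite slice1E.
(* The coefficient at [Y_(n+k)] is affine in [k]: two values of [k] separate the
   contributions of [L_n] and [N_n]. *)
have tLN n q : t@_(eL n, q) = 0 /\ t@_(eN n, q) = 0.
  have tY (k : int) : (B < `|(n + k)%R|)%N ->
      - (plus_half F k - n%:~R / 2%:R) * t@_(eL n, q) - t@_(eN n, q) = 0.
    by move=> Bk; have := key (eY k) (eY (n + k)) q isT Bk; rewrite /= addrK.
  pose k : int := (B + `|n|)%N.+1.
  have e0 := tY k ltac:(lia); have e1 := tY (k + 1) ltac:(lia).
  have tL0 : t@_(eL n, q) = 0.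
    apply/eqP; rewrite -oppr_eq0; apply/eqP.
    rewrite -(subrr (0 : F)) -{1}e1 -e0 /plus_half rmorphD /=; ring.
  by split=> //; move/eqP: e0; rewrite tL0 mulr0 add0r oppr_eq0 => /eqP.
apply/malgP=> -[[] n q]; rewrite mcoeff0.
- by have [] := tLN n q.
- have := key (eN (B + `|n|)%N.+1) (eM (n + (B + `|n|)%N.+1)) q isT.
  rewrite /= addrK => /(_ ltac:(lia)) /eqP.
  by rewrite mulf_eq0 (negPf two_neq0) => /eqP.
- by have [] := tLN n q.
- pose k : int := (B + `|n|)%N.+1.
  have := key (eY k) (eM (n + k + 1)) q isT.
  have -> : coad (eY k) (eM (n + k + 1)) (fun i => t@_(i, q)) =
            (n - k)%:~R * t@_(eY n, q).
    have en : n + k + 1 - k - 1 = n by lia.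
    by rewrite /= en /plus_half rmorphB /=; ring.
  move=> /(_ ltac:(rewrite /=; lia)) /eqP; rewrite mulf_eq0 intr_eq0_char0 // subr_eq0.
  have -> /= : (n == k) = false by rewrite /k; lia.
  by move/eqP.
Qed.

End Invariants.

(** * Functions of an integer with affine increments *)

Section AffineIncrements.
Variables (F : fieldType) (charF0 : [pchar F] =i pred0).

Lemma additive_intE (f : int -> F) :
  {morph f : m n / m + n} -> forall m, f m = m%:~R * f 1.
Proof.
move=> fD; have f0 : f 0 = 0 by apply: (addrI (f 0)); rewrite -fD !addr0.
have fn (n : nat) : f n = n%:R * f 1.
  elim: n => [|n IHn]; first by rewrite f0 mul0r.
  by rewrite -addn1 PoszD fD IHn natrD mulrDl mul1r.
case=> n; first exact: fn.
apply: (addrI (f n.+1)); rewrite -fD NegzE subrr f0 fn rmorphN /=; ring.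
Qed.

(** Splitting the increment over [m + n] in two steps and comparing the
    coefficients of [k] gives the additivity of [u]. *)
Lemma affine_increment_slope (G u v : int -> F) :
  (forall k m, G (k + m) = G k + k%:~R * u m + v m) ->
  forall m, u m = m%:~R * u 1.
Proof.
move=> GD; apply: additive_intE => m n.
have e k : k%:~R * u (m + n) + v (m + n) =
           k%:~R * (u m + u n) + (v m + m%:~R * u n + v n).
  by apply: (addrI (G k)); rewrite addrA -GD addrA GD GD rmorphD /=; ring.
have := e 1; have := e 0; rewrite !mul1r !mul0r !add0r => ->.
by move/addIr.
Qed.

Lemma constant_incrementE (G v : int -> F) :
  (forall k m, G (k + m) = G k + v m) -> forall m, v m = m%:~R * v 1.
Proof.
move=> GD; apply: additive_intE => m n.
by apply: (addrI (G 0)); rewrite -GD addrA GD GD addrA.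
Qed.

(** The first relation makes [f m i j / m] a function of [i - m] and [j], the
    second one a function of [i] and [j - m].  Hence [f 1 i j] is unchanged by the
    shifts [(i, j) -> (i + m - 1, j - m + 1)], which leave any finite support. *)
Lemma shift_eq0 (f : int -> int -> int -> F) (B : nat) :
  (forall m i j, f m (m + i) j = m%:~R * f 1 (1 + i) j) ->
  (forall m i j, f m i (m + j) = m%:~R * f 1 i (1 + j)) ->
  (forall i j, (B < `|i|)%N -> f 1 i j = 0) ->
  forall m i j, f m i j = 0.
Proof.
move=> f_shl f_shr fB.
have f1 i j : f 1 i j = 0.
  pose m : int := (B + `|i|).+2.
  have e : m%:~R * f 1 i j = m%:~R * f 1 (i + m - 1) (1 + (j - m)).
    rewrite -f_shr addrCA subrr addr0.
    have -> : i + m - 1 = m + (i - 1) by lia.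
    by rewrite f_shl; congr (_ * f _ _ _); lia.
  have m0 : (m%:~R : F) != 0 by rewrite intr_eq0_char0.
  by rewrite (mulfI m0 e) fB //; rewrite /m; lia.
by move=> m i j; rewrite -[i](addrNK m) addrC f_shl f1 mulr0.
Qed.

End AffineIncrements.

(** * Normalized cocycles vanish on N and Y *)

Section Cocycle.
Variables (F : fieldType) (charF0 : [pchar F] =i pred0).

(** In this part [c x a b] stands for the coefficient of [D x] at [a \ox b].  The
    cocycle condition on [[N_m, Y_k]], in coefficients, is the next definition;
    working with functions makes the exchange of the two legs a symmetry. *)
Definition NY_cocycle (c : esv_index -> esv_index -> esv_index -> F) :=
  forall m k a b, c (eY (m + k)) a b =
    coad (eN m) a (fun i => c (eY k) i b) + coad (eN m) b (fun j => c (eY k) a j)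
    - coad (eY k) a (fun i => c (eN m) i b)
    - coad (eY k) b (fun j => c (eN m) a j).

Lemma NY_cocycle_swap c : NY_cocycle c -> NY_cocycle (fun x a b => c x b a).
Proof. by move=> cP m k a b; rewrite cP; ring. Qed.

(** Along the translation by [m], the coefficient of [D Y_k] at [Y \ox L] has an
    increment that is affine in [k], because [[Y_p, L_n] = - (p - n / 2) Y_(p+n)]
    is affine in [p]. *)
Lemma NY_cocycle_YL c : NY_cocycle c -> forall m k d s,
  c (eY (k + m)) (eY (k + m + d)) (eL s) = c (eY k) (eY (k + d)) (eL s)
  + k%:~R * c (eN m) (eL (m + d)) (eL s)
  + ((1 - (m + d)%:~R) / 2%:R * c (eN m) (eL (m + d)) (eL s)
     + c (eN m) (eN (m + d)) (eL s)).
Proof.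
move=> cP m k d s; rewrite [k + m]addrC cP /= /plus_half.
have -> : m + k + d - m = k + d by lia.
have -> : m + k + d - k = m + d by lia.
ring.
Qed.

(** The same at [Y \ox N]; the last term comes from [[N_m, L_n] = - m N_(m+n)]
    in the second leg. *)
Lemma NY_cocycle_YN c : NY_cocycle c -> forall m k d s,
  c (eY (k + m)) (eY (k + m + d)) (eN s) = c (eY k) (eY (k + d)) (eN s)
  + k%:~R * c (eN m) (eL (m + d)) (eN s)
  + ((1 - (m + d)%:~R) / 2%:R * c (eN m) (eL (m + d)) (eN s)
     + c (eN m) (eN (m + d)) (eN s))
  - m%:~R * c (eY k) (eY (k + m + d)) (eL (s - m)).
Proof.
move=> cP m k d s; rewrite [k + m]addrC cP /= /plus_half.
have -> : m + k + d - m = k + d by lia.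
have -> : m + k + d - k = m + d by lia.
ring.
Qed.

Lemma NY_cocycle_LL c (B : nat) : NY_cocycle c ->
  (forall a b, (B < `|idx a|)%N -> c (eN 1) a b = 0) ->
  forall m i j, c (eN m) (eL i) (eL j) = 0.
Proof.
have slope c' : NY_cocycle c' -> forall m d s,
    c' (eN m) (eL (m + d)) (eL s) = m%:~R * c' (eN 1) (eL (1 + d)) (eL s).
  move=> c'P m d s; exact: affine_increment_slope
    (fun k m => NY_cocycle_YL c'P m k d s) m.
move=> cP cB; apply: (shift_eq0 charF0 (B := B)).
- by move=> m i j; apply: slope.
- by move=> m i j; apply: (slope _ (NY_cocycle_swap cP)).
- by move=> i j Bi; apply: cB.
Qed.

Lemma NY_cocycle_NL c : NY_cocycle c ->
  (forall m i j, c (eN m) (eL i) (eL j) = 0) -> forall m d s,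
  c (eN m) (eN (m + d)) (eL s) = m%:~R * c (eN 1) (eN (1 + d)) (eL s) /\
  c (eY m) (eY (m + d)) (eL s) = c (eY 0) (eY d) (eL s) +
                                 c (eN m) (eN (m + d)) (eL s).
Proof.
move=> cP LL m d s.
have e k n : c (eY (k + n)) (eY (k + n + d)) (eL s) =
    c (eY k) (eY (k + d)) (eL s) + c (eN n) (eN (n + d)) (eL s).
  by rewrite NY_cocycle_YL // LL !mulr0 addr0 add0r.
split; last by have := e 0 m; rewrite !add0r.
exact: (constant_incrementE (G := fun k => c (eY k) (eY (k + d)) (eL s))
         (v := fun n => c (eN n) (eN (n + d)) (eL s))).
Qed.

Lemma NY_cocycle_NN c : NY_cocycle c ->
  (forall k i j, c (eY k) (eY i) (eL j) = 0) ->
  (forall m i j, c (eN m) (eL i) (eN j) = 0) -> forall m d s,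
  c (eN m) (eN (m + d)) (eN s) = m%:~R * c (eN 1) (eN (1 + d)) (eN s) /\
  c (eY m) (eY (m + d)) (eN s) = c (eY 0) (eY d) (eN s) +
                                 c (eN m) (eN (m + d)) (eN s).
Proof.
move=> cP YL LN m d s.
have e k n : c (eY (k + n)) (eY (k + n + d)) (eN s) =
    c (eY k) (eY (k + d)) (eN s) + c (eN n) (eN (n + d)) (eN s).
  by rewrite NY_cocycle_YN // LN YL !mulr0 subr0 addr0 add0r.
split; last by have := e 0 m; rewrite !add0r.
exact: (constant_incrementE (G := fun k => c (eY k) (eY (k + d)) (eN s))
         (v := fun n => c (eN n) (eN (n + d)) (eN s))).
Qed.

Definition YY_cocycle (c : esv_index -> esv_index -> esv_index -> F) :=
  forall k l a b, (plus_half F l - plus_half F k) * c (eM (k + l + 1)) a b =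
    coad (eY k) a (fun i => c (eY l) i b) + coad (eY k) b (fun j => c (eY l) a j)
    - coad (eY l) a (fun i => c (eY k) i b)
    - coad (eY l) b (fun j => c (eY k) a j).

(** The last four conditions use up the freedom of changing a cocycle by the
    coboundary of a tensor of type L \ox L, N \ox L, L \ox N and N \ox N
    respectively. *)
Record normalized (c : esv_index -> esv_index -> esv_index -> F) : Prop := {
  norm_wt : forall x a b, is_NY x -> (wt a + wt b)%N != wt x -> c x a b = 0;
  norm_NL : forall i j, c (eN 1) (eN i) (eL j) = 0;
  norm_YL : forall i j, c (eY 0) (eY i) (eL j) = 0;
  norm_LY : forall i j, c (eY 0) (eL i) (eY j) = 0;
  norm_YN : forall i j, c (eY 0) (eY i) (eN j) = 0
}.

(** The types are treated in the order LL, NL, YL, LN, LY, NN, YN, each one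
    using that the terms of previous types in its relation are gone: [shift_eq0]
    applies to LL, LN and NN, and in the other types the normalization at [N_1] or
    [Y_0] propagates to all indices.  The type NY is left to [[Y_k, Y_l]]. *)
Lemma normalized_cocycle_eq0 c (B : nat) :
  NY_cocycle c -> YY_cocycle c -> normalized c ->
  (forall x a b, x = eN 1 \/ x = eY 0 -> (B < `|idx a|)%N -> c x a b = 0) ->
  forall x a b, is_NY x -> c x a b = 0.
Proof.
move=> cP cYY [c_wt c_NL c_YL c_LY c_YN] cB.
have cP' := NY_cocycle_swap cP.
have N1B a b : (B < `|idx a|)%N -> c (eN 1) a b = 0 by apply: cB; left.
have Y0B a b : (B < `|idx a|)%N -> c (eY 0) a b = 0 by apply: cB; right.
have LL := NY_cocycle_LL cP N1B.
have NL m i j : c (eN m) (eN i) (eL j) = 0.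
  by rewrite -[i](addrNK m) addrC (NY_cocycle_NL cP LL _ _ _).1 c_NL mulr0.
have YL k i j : c (eY k) (eY i) (eL j) = 0.
  rewrite -[i](addrNK k) addrC (NY_cocycle_NL cP LL _ _ _).2.
  by rewrite c_YL NL addr0.
have LL' m i j : c (eN m) (eL j) (eL i) = 0 by [].
have LN m i j : c (eN m) (eL i) (eN j) = 0.
  apply: (shift_eq0 charF0 (B := B) (f := fun m i j => c (eN m) (eL i) (eN j))).
  - move=> {}m {}i {}j.
    apply: (affine_increment_slope (G := fun k => c (eY k) (eY (k + i)) (eN j))
      (u := fun m => c (eN m) (eL (m + i)) (eN j))
      (v := fun m => (1 - (m + i)%:~R) / 2%:R * c (eN m) (eL (m + i)) (eN j)
     + c (eN m) (eN (m + i)) (eN j))) => k n.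
    by rewrite NY_cocycle_YN // YL mulr0 subr0.
  - by move=> {}m {}i {}j; apply: (NY_cocycle_NL cP' LL' _ _ _).1.
  - by move=> {}i {}j ?; apply: N1B.
have LY k i j : c (eY k) (eL i) (eY j) = 0.
  rewrite -[j](addrNK k) addrC (NY_cocycle_NL cP' LL' _ _ _).2.
  by rewrite c_LY LN addr0.
have NN m i j : c (eN m) (eN i) (eN j) = 0.
  apply: (shift_eq0 charF0 (B := B) (f := fun m i j => c (eN m) (eN i) (eN j))).
  - by move=> {}m {}i {}j; apply: (NY_cocycle_NN cP YL LN _ _ _).1.
  - move=> {}m {}i {}j.
    by apply: (NY_cocycle_NN cP' (fun k i j => LY k j i) (fun m i j => NL m j i)
      _ _ _).1.
  - by move=> {}i {}j ?; apply: N1B.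
have YN k i j : c (eY k) (eY i) (eN j) = 0.
  rewrite -[i](addrNK k) addrC (NY_cocycle_NN cP YL LN _ _ _).2.
  by rewrite c_YN NN addr0.
have NY k i j : c (eY k) (eN i) (eY j) = c (eY 0) (eN i) (eY (j - k)).
  rewrite -{1}[j](addrNK k) addrC.
  rewrite (NY_cocycle_NN cP' (fun k i j => LY k j i) (fun m i j => NL m j i)
    _ _ _).2.
  by rewrite NN addr0.
(* What is left of [D Y_k] depends on [D Y_0] alone, and the bracket
   [[Y_k, Y_l]] constrains it. *)
have YY k l i j : (plus_half F l - plus_half F k) *
    c (eM (k + l + 1)) (eY i) (eY j) =
    c (eY 0) (eN (i - l)) (eY (j - k)) - c (eY 0) (eN (i - k)) (eY (j - l)).
  by rewrite cYY /= !YL !YN !LY (NY l (i - k)) (NY k (i - l)); ring.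
have diff k l : plus_half F l - plus_half F k = (l - k)%:~R.
  by rewrite /plus_half rmorphB /=; ring.
have MYY n i j : c (eM n) (eY i) (eY j) = 0.
  (* Both terms on the right of [YY] are outside the support for this [k]. *)
  pose k : int := (B + `|i| + `|n|)%N.*2.+2.
  have := YY k (n - 1 - k) i j.
  have -> : k + (n - 1 - k) + 1 = n by lia.
  rewrite !Y0B /= ?subr0; [|rewrite /k; lia..].
  move/eqP; rewrite mulf_eq0 diff intr_eq0_char0 // => /orP[|/eqP //].
  by rewrite /k; lia.
have NY0 i j : c (eY 0) (eN i) (eY j) = 0.
  pose k : int := (B + `|i|)%N.+1.
  have := YY k 0 i (j + k); rewrite MYY mulr0 subr0 addrK.
  by rewrite [c _ (eN (i - k)) _]Y0B /= ?subr0 //; rewrite /k; lia.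
case=> m a b //= _.
- case: a => i; case: b => j; rewrite ?LL ?LN ?NL ?NN //; exact: c_wt.
- case: a => i; case: b => j; rewrite ?YL ?YN ?LY 1?NY ?NY0 //; exact: c_wt.
Qed.

End Cocycle.

(** * Every cocycle with values in the tensor square is a coboundary *)

Section Coboundary.
Variables (F : fieldType) (charF0 : [pchar F] =i pred0).
Local Notation V := {malg F[esv_index]}.
Local Notation V2 := {malg F[(esv_index * esv_index)%type]}.
Local Notation br := (@esv_bracket F).
Hypothesis br_lie : is_lie_algebra br.

Definition cocycle (E : V -> V2) : Prop :=
  forall x y, E (br x y) = adj_act br x (E y) - adj_act br y (E x).

Lemma adj_actE x t a b : is_NY x ->
  (adj_act br << x >> t)@_(a, b) =
  coad x a (fun i => t@_(i, b)) + coad x b (fun j => t@_(a, j)).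
Proof.
move=> NYx; rewrite -[adj_act _ _]/(leib (br << x >>) (br << x >>)).
rewrite leibE; [|exact: esv_bracket_linearr..].
rewrite !coadE //; congr (_ + _); apply: eq_coad => i.
  by rewrite slice1E.
by rewrite slice2E.
Qed.

Lemma bounded_malg (f : esv_index * esv_index -> F) (B : nat) :
  (forall a b, (B < `|idx a|)%N || (B < `|idx b|)%N -> f (a, b) = 0) ->
  exists r : V2, forall p, r@_p = f p.
Proof.
move=> fB.
pose s := [seq i%:Z - B%:Z | i <- iota 0 (B + B).+1].
pose S := flatten [seq [:: eL n; eM n; eN n; eY n] | n <- s].
have S_in a : (`|idx a| <= B)%N -> a \in S.
  move=> aB; apply/flatten_mapP; exists (idx a).
    apply/mapP; exists `|(idx a + B%:Z)%R|%N; last by lia.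
    by rewrite mem_iota; lia.
  by case: a {aB} => n; rewrite !inE eqxx ?orbT.
exists [malg p in seq_fset tt [seq (a, b) | a <- S, b <- S] => f p] => -[a b].
rewrite mcoeffE; case: ifP => // /negbT; rewrite seq_fsetE => notS.
apply/esym/fB; rewrite !ltnNge -negb_and; apply: contra notS => /andP[aB bB].
by apply: allpairs_f; apply: S_in.
Qed.

Lemma mcoeff_bound2 (t : V2) :
  exists B : nat, forall a b, (B < `|idx a|)%N || (B < `|idx b|)%N ->
    t@_(a, b) = 0.
Proof.
have [B1 t1] := mcoeff_bound t (fun p => idx p.1).
have [B2 t2] := mcoeff_bound t (fun p => idx p.2).
exists (B1 + B2)%N => a b /orP[] B.
  by apply: t1; apply: leq_ltn_trans B; apply: leq_addr.
by apply: t2; apply: leq_ltn_trans B; apply: leq_addl.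
Qed.

Let natr_neq0 n : (n.+1%:R : F) != 0.
Proof. by rewrite ((pcharf0P F).1 charF0). Qed.

(** The prescribed coefficients of the coboundary form a triangular system: the
    part of [r] of nonzero weight is governed by [N_0], its part in L \ox L by
    [N_1], and then [Y_0] determines the other three parts, N \ox N last. *)
Lemma normalizing_tensor (t0 t1 tY : V2) : exists r : V2,
  [/\ forall a b, (wt a + wt b)%N != 0%N ->
        (adj_act br << eN 0 >> r)@_(a, b) = t0@_(a, b),
      forall i j, (adj_act br << eN 1 >> r)@_(eN i, eL j) = t1@_(eN i, eL j),
      forall i j, (adj_act br << eY 0 >> r)@_(eY i, eL j) = tY@_(eY i, eL j),
      forall i j, (adj_act br << eY 0 >> r)@_(eL i, eY j) = tY@_(eL i, eY j)
    & forall i j, (adj_act br << eY 0 >> r)@_(eY i, eN j) = tY@_(eY i, eN j)].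
Proof.
(* [- q i] is the coefficient of [[Y_0, L_i]]. *)
pose q (i : int) : F := (1 - i%:~R) / 2%:R.
pose LL i j := - t1@_(eN (i + 1), eL j).
pose NL i j := - tY@_(eY i, eL j) - q i * LL i j.
pose LN i j := - tY@_(eL i, eY j) - q j * LL i j.
pose NN i j := - tY@_(eY i, eN j) - q i * LN i j.
pose f p := match p : esv_index * esv_index with
  | (eL i, eL j) => LL i j | (eN i, eL j) => NL i j
  | (eL i, eN j) => LN i j | (eN i, eN j) => NN i j
  | (a, b) => t0@_(a, b) / (wt a + wt b)%:R end.
have [B0 t0B] := mcoeff_bound2 t0.
have [B1 t1B] := mcoeff_bound2 t1.
have [BY tYB] := mcoeff_bound2 tY.
have LL0 i j : (B1.+1 < `|i|)%N || (B1.+1 < `|j|)%N -> LL i j = 0.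
  by move=> Bij; rewrite /LL t1B ?oppr0 //=; lia.
have tY0 a b : (BY < `|idx a|)%N || (BY < `|idx b|)%N -> tY@_(a, b) = 0.
  exact: tYB.
have LN0 i j : (BY + B1.+1 < `|i|)%N || (BY + B1.+1 < `|j|)%N -> LN i j = 0.
  move=> Bij; rewrite /LN LL0 ?tY0 ?mulr0 ?oppr0 ?addr0 //=; lia.
have [r rE] : exists r : V2, forall p, r@_p = f p.
  apply: (bounded_malg (B := (B0 + BY + B1.+1)%N)) => -[] i [] j /= Bij.
  all: try by rewrite t0B ?mul0r //=; lia.
  - by apply: LL0; lia.
  - by apply: LN0; lia.
  - by rewrite /NL LL0 ?tY0 ?mulr0 ?oppr0 ?addr0 //=; lia.
  - by rewrite /NN LN0 ?tY0 ?mulr0 ?oppr0 ?addr0 //=; lia.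
have h2 : (2%:R : F) != 0 by apply: natr_neq0.
exists r; split=> [a b|i j|i j|i j|i j]; rewrite adj_actE //.
- move=> wt0; rewrite !coad_N0 -mulrDl rE -natrD.
  have n0 : ((wt a + wt b)%:R : F) != 0.
    by case: (wt a + wt b)%N wt0 => // n _; apply: natr_neq0.
  have -> : f (a, b) = t0@_(a, b) / (wt a + wt b)%:R.
    by move: wt0; rewrite /f; case: (a) => ?; case: (b) => ?.
  by rewrite mulrCA divff // mulr1.
- by rewrite /= addr0 rE /= /LL subrK; ring.
- by rewrite /= !rE /= /NL subr0 /q /plus_half; field.
- by rewrite /= !rE /= /LN subr0 /q /plus_half; field.
- by rewrite /= !rE /= /NN subr0 /q /plus_half; field.
Qed.

Lemma cocycle_mcoeff (E : V -> V2) x y a b : cocycle E -> is_NY x -> is_NY y ->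
  (E (br << x >> << y >>))@_(a, b) =
    coad x a (fun i => (E << y >>)@_(i, b))
    + coad x b (fun j => (E << y >>)@_(a, j))
    - coad y a (fun i => (E << x >>)@_(i, b))
    - coad y b (fun j => (E << x >>)@_(a, j)).
Proof.
move=> E_coc NYx NYy; rewrite E_coc -addrA -opprD; apply: etrans (mcoeffB _ _ _) _.
by apply: (congr2 (fun s t => s - t)); apply: adj_actE.
Qed.

(** For [x] of weight [w], the cocycle condition on [[N_0, x] = w x] says that
    [N_0 - w] maps [E x] to [x . E N_0], which is homogeneous of weight [w]; but
    the image of [N_0 - w] has no component of weight [w], so [E x] must have
    weight [w]. *)
Lemma cocycle_normalized (E : V -> V2) : linear E -> cocycle E ->
  (forall a b, (wt a + wt b)%N != 0%N -> (E << eN 0 >>)@_(a, b) = 0) ->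
  forall x a b, is_NY x -> (wt a + wt b)%N != wt x -> (E << x >>)@_(a, b) = 0.
Proof.
move=> E_lin E_coc EN0 x a b NYx wtx.
have brN0 : br << eN 0 >> << x >> = (wt x)%:R *: << x >>.
  by case: x {wtx} NYx => // n _; rewrite esv_bracketUU /= ?scale0r // add0r scale1r.
have := cocycle_mcoeff a b E_coc (x := eN 0) isT NYx.
rewrite brN0 (linZ E_lin) mcoeffZ.
rewrite !coad_N0 (@coad_wt _ x a) ?(@coad_wt _ x b) //; first last.
- by move=> i wti; apply: EN0; move: wtx; rewrite -wti; lia.
- by move=> i wti; apply: EN0; move: wtx; rewrite -wti; lia.
rewrite !(addr0, subr0) -mulrDl -natrD => /eqP.
rewrite eq_sym -subr_eq0 -mulrBl mulf_eq0 => /orP[|/eqP //].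
rewrite -[_%:R]/((wt a + wt b)%:Z%:~R) -[(wt x)%:R]/((wt x)%:Z%:~R) -rmorphB.
by rewrite /= intr_eq0_char0 // subr_eq0 eqz_nat (negPf wtx).
Qed.

(** Once [E] vanishes on N and Y, it vanishes on M by [[Y_p, Y_q]], while [E L_m]
    is annihilated by N and Y. *)
Lemma normalized_cocycle_vanishes (E : V -> V2) : linear E -> cocycle E ->
  normalized (fun x a b => (E << x >>)@_(a, b)) -> forall x, E x = 0.
Proof.
move=> E_lin E_coc E_norm.
pose c x a b := (E << x >>)@_(a, b).
have E_NY x : is_NY x -> E << x >> = 0.
  have [B1 B1P] := mcoeff_bound2 (E << eN 1 >>).
  have [BY BYP] := mcoeff_bound2 (E << eY 0 >>).
  move=> NYx; apply/malgP=> -[a b]; rewrite mcoeff0.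
  apply: (normalized_cocycle_eq0 charF0 (c := c) (B := (B1 + BY)%N)) => //.
  - move=> m k {}a {}b.
    have := cocycle_mcoeff a b E_coc (isT : is_NY (eN m)) (isT : is_NY (eY k)).
    by rewrite esv_bracketUU.
  - move=> k l {}a {}b.
    have := cocycle_mcoeff a b E_coc (isT : is_NY (eY k)) (isT : is_NY (eY l)).
    by rewrite esv_bracketUU /= (linZ E_lin) mcoeffZ.
  - move=> y {}a {}b [] -> Ba; first by apply: B1P; lia.
    by apply: BYP; lia.
have act0 y : adj_act br y 0 = 0 by apply: linear0.
have E_L m : E << eL m >> = 0.
  apply: (NY_invariant_eq0 charF0 (g := fun x => br << x >>)).
    by move=> x; apply: esv_bracket_linearr.
  move=> x NYx; have := E_coc << x >> << eL m >>.
  rewrite (E_NY x NYx) act0 subr0 => e; apply: etrans (esym e) _ => {e}.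
  rewrite esv_bracketUU; case: x NYx => n // _ /=.
    by rewrite (linN E_lin) (linZ E_lin) E_NY // scaler0 oppr0.
  by rewrite (linN E_lin) (linZ E_lin) E_NY // scaler0 oppr0.
have E_M n : E << eM n >> = 0.
  have [k nk] : exists k : int, plus_half F (n - k - 1) - plus_half F k != 0.
    have e (k : int) : plus_half F (n - k - 1) - plus_half F k = (n - k - 1 - k)%:~R.
      by rewrite /plus_half [RHS]rmorphB /=; ring.
    exists (`|n| + 1)%N; rewrite e intr_eq0_char0 //; lia.
  have := E_coc << eY k >> << eY (n - k - 1) >>.
  rewrite (E_NY (eY k) isT) (E_NY (eY (n - k - 1)) isT).
  rewrite !act0 subr0 esv_bracketUU /= (linZ E_lin).
  have -> : k + (n - k - 1) + 1 = n by lia.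
  by move/eqP; rewrite scaler_eq0 (negPf nk) => /eqP.
apply: (eq_linear E_lin (g := fun=> 0)) => [c' x y|[] n] //=.
- by rewrite scaler0 addr0.
- exact: E_NY.
- exact: E_NY.
Qed.

Theorem cocycle_coboundary (D : V -> V2) : linear D -> cocycle D ->
  exists r, forall x, D x = adj_act br x r.
Proof.
move=> D_lin D_coc.
have [r [r0 r1 r2 r3 r4]] :=
  normalizing_tensor (D << eN 0 >>) (D << eN 1 >>) (D << eY 0 >>).
exists r => x; apply/eqP; rewrite -subr_eq0; apply/eqP; move: x.
pose E x := D x - adj_act br x r.
have E_lin : linear E.
  by move=> c x y; rewrite /E D_lin (adj_act_linearl br_lie) opprD addrACA scalerBr.
have E_coc : cocycle E.
  move=> x y; rewrite /E D_coc (adj_act_bracket br_lie).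
  rewrite (linB (adj_act_linear br x)) (linB (adj_act_linear br y)).
  have subACA (s t u v : V2) : s - t - (u - v) = s - u - (t - v).
    by rewrite opprD addrACA -opprD.
  exact: subACA.
apply: (normalized_cocycle_vanishes E_lin E_coc).
have E0 x a b : (adj_act br << x >> r)@_(a, b) = (D << x >>)@_(a, b) ->
    (E << x >>)@_(a, b) = 0 by rewrite mcoeffB => ->; rewrite subrr.
split=> [x a b|i j|i j|i j|i j]; try exact: E0.
by apply: cocycle_normalized => // {}a {}b wt0; apply: E0; apply: r0.
Qed.

End Coboundary.

(** * Lie bialgebra structures *)

Lemma tau_involutive (F : fieldType) (K : choiceType) : involutive (@tau F K).
Proof.
apply: eq_linear_tens => [c s t|c s t|u v] //=; first by rewrite !linearP.
by rewrite !tau_tens.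
Qed.

Theorem theorem3p7 (F : fieldType) (charF0 : [pchar F] =i pred0)
    (D : {linear {malg F[esv_index]} -> {malg F[(esv_index * esv_index)%type]}}) :
  is_lie_bialgebra (@esv_bracket F) D ->
  triangular_coboundary (@esv_bracket F) D.
Proof.
case=> br_lie [D_skew D_coJacobi] D_coc.
have [r Dr] := cocycle_coboundary charF0 br_lie (linearP D) D_coc.
have r_skew : tau r = - r.
  apply/eqP; rewrite -addr_eq0; apply/eqP.
  apply: (NY_invariant_eq0 charF0 (g := fun x => esv_bracket << x >>)).
    by move=> x; apply: esv_bracket_linearr.
  move=> x _; rewrite -[leib _ _]/(adj_act (@esv_bracket F) << x >>).
  rewrite adj_actD (adj_act_tau br_lie) -Dr.
  have [t ->] := D_skew << x >>.
  by rewrite (linearB (@tau F esv_index)) /= tau_involutive addrA subrK subrr.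
exists r; split=> //.
apply: (NY_invariant_eq0 charF0 (g := fun x => adj_act (@esv_bracket F) << x >>)).
  by move=> x; apply: linearP.
move=> x _; rewrite -[leib _ _ _]/(adj_act3 _ _ _).
rewrite -(co_jacobi_cybe br_lie r_skew << x >>) /= -Dr.
have idD t : id_tens (fun y => adj_act (@esv_bracket F) y r) t = id_tens D t.
  by apply: eq_linext => p; rewrite Dr.
by rewrite !idD; apply: D_coJacobi.
Qed.
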